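(* For every $n$, the number $\mathcal{A}_n$ of $n\times n$ alternating sign matrices is $$\mathcal{A}_n=3^{-\binom n2}H_n(\hat C).$$
   Context: An $n\times n$ alternating sign matrix is an $n\times n$ matrix with entries in $\{0,1,-1\}$ such that every row sum and column sum is $1$ and the nonzero entries in each row and each column alternate in sign; it is known that their number is $\mathcal A_n=\prod_{k=0}^{n-1}\frac{(3k+1)!}{(n+k)!}$. The formal power series $\hat C$ is $$\hat C(x)=\frac{1-(1-9x)^{1/3}}{3x}.$$ For a formal power series $A(x)=\sum_{k\ge0}A_kx^k$, $H_n(A)=\det(A_{i+j})_{0\le i,j\le n-1}$. *)

(* Defs.v *)
From HB Require Import structures.
From mathcomp Require Import all_boot all_order all_algebra.

Set Implicit Arguments.
Unset Strict Implicit.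
Unset Printing Implicit Defensive.

Import Order.TTheory GRing.Theory Num.Theory.
Local Open Scope ring_scope.

Definition alternating (s : seq int) : bool :=
  sorted (fun x y => x * y < 0) [seq x <- s | x != 0].

Definition row_seq n (A : 'M[int]_n) (i : 'I_n) : seq int :=
  [seq A i j | j <- enum 'I_n].
Definition col_seq n (A : 'M[int]_n) (j : 'I_n) : seq int :=
  [seq A i j | i <- enum 'I_n].

Definition is_asm n (A : 'M[int]_n) : bool :=
  [&& [forall i, forall j, A i j \in [:: 0; 1; -1]],
      [forall i, \sum_j A i j == 1],
      [forall j, \sum_i A i j == 1],
      [forall i, alternating (row_seq A i)]
    & [forall j, alternating (col_seq A j)]].

(* Integer matrices do not form a finType, so alternating sign matrices are   *)
(* counted as matrices over the finite subtype {0, 1, -1} of int; num_asmP    *)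
(* shows that this is the number of integer matrices satisfying is_asm.       *)
Definition asm_entry : finType := seq_sub [:: 0; 1; -1 : int].

Definition num_asm (n : nat) : nat :=
  #|[set A : 'M[asm_entry]_n | is_asm (map_mx val A)]|.

Lemma num_asmP n (s : seq 'M[int]_n) :
  uniq s -> (forall A, (A \in s) = is_asm A) -> num_asm n = size s.
Proof.
move=> s_uniq sE.
have inj : injective (fun A : 'M[asm_entry]_n => map_mx val A).
  move=> A B /matrixP eqAB; apply/matrixP=> i j; apply: val_inj.
  by have := eqAB i j; rewrite !mxE.
rewrite /num_asm cardE -(size_map (fun A : 'M[asm_entry]_n => map_mx val A)).
apply/perm_size/uniq_perm; rewrite ?map_inj_uniq ?enum_uniq // => A.
rewrite sE; apply/mapP/idP => [[B]|A_asm].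
  by rewrite mem_enum inE => B_asm ->.
have /andP[/forallP A_entry _] := A_asm.
have {}A_entry i j : A i j \in [:: 0; 1; -1] by have /forallP := A_entry i.
pose B : 'M[asm_entry]_n := \matrix_(i, j) SeqSub (A_entry i j).
have AB : A = map_mx val B by apply/matrixP=> i j; rewrite !mxE.
by exists B; rewrite // mem_enum inE -AB.
Qed.

(* A formal power series over R is represented by its coefficient sequence.   *)
Definition fps (R : Type) := nat -> R.

Definition fps_one (R : nzRingType) : fps R := fun k => (k == 0%N)%:R.
Definition fps_sub (R : nzRingType) (A B : fps R) : fps R :=
  fun k => A k - B k.
Definition fps_scale (R : nzRingType) (c : R) (A : fps R) : fps R :=
  fun k => c * A k.

(* A(x) / x, meaningful when A has zero constant term. *)
Definition fps_divX (R : nzRingType) (A : fps R) : fps R := fun k => A k.+1.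

Definition gbinom (F : fieldType) (a : F) (k : nat) : F :=
  (\prod_(i < k) (a - i%:R)) / k`!%:R.

(* (1 + c x) ^ a, by the binomial series. *)
Definition binomial_series (F : fieldType) (c a : F) : fps F :=
  fun k => gbinom a k * c ^+ k.

Definition C_hat : fps rat :=
  fps_scale 3^-1
    (fps_divX (fps_sub (fps_one rat) (binomial_series (- 9) 3^-1))).

Lemma C_hat_numerator0 :
  fps_sub (fps_one rat) (binomial_series (- 9) 3^-1) 0 = 0.
Proof.
by rewrite /fps_sub /fps_one /binomial_series /gbinom big_ord0 divr1 mul1r subrr.
Qed.

Definition hankel_det (R : comNzRingType) (n : nat) (A : fps R) : R :=
  \det (\matrix_(i < n, j < n) A (i + j)%N).

(* Main.v *)
Require Import Defs.
From HB Require Import structures.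
From mathcomp Require Import all_boot all_order all_algebra all_fingroup all_field.
From mathcomp Require Import ring zify.

(** The proof counts alternating sign matrices with the six-vertex model.

    Reading off the partial row sums and the partial column sums, which all
    lie in {0, 1}, turns an alternating sign matrix into a configuration of the
    six-vertex model on a square with domain-wall boundary ([num_asm_grid_sum]).
    Row i carries a parameter x_i and column j a parameter y_j.  With w a
    primitive cube root of unity, the six vertex weights of [weight] all equal
    w - w^2 when x = y = 1, so the partition function Z there is
    (w - w^2)^(n^2) times the number of matrices.

    The Yang-Baxter equation ([yang_baxter]) makes Z symmetric in the x_i.
    As a function of the parameter y of the first column, Z is a polynomial of
    degree less than n ([grid_sum_column_poly]), and at y = w^2 x_i the corner
    vertex freezes the first row and column, which expresses Z by the smaller
    square ([grid_sum_corner]).  Interpolation then gives the Izergin-Korepin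
    formula ([izergin_korepin_formula]): up to explicit factors, Z times the two
    Vandermonde determinants is the determinant of 1 / (x_i^2 + x_i y_j + y_j^2).

    It remains to let all parameters tend to 1.  Since
    1 / (x^2 + x y + y^2) = (x - y) / (x^3 - y^3), the good choice is
    x = (1 + S)^(1/3) and y = (1 + T)^(1/3): if the a_k are the coefficients
    of (1 + S)^(1/3), the kernel becomes the divided difference
      sum_k a_k (S^k - T^k) / (S - T) = sum_(k, l) a_(k+l+1) S^k T^l,
    whose coefficient matrix is a Hankel matrix.  With S = u_i X and T = v_j X,
    the lowest coefficient in X of its determinant is the Hankel determinant of
    the a_(i+j+1) times the Vandermonde determinants of u and v
    ([det_scaled_lead]), and the Vandermonde determinants on the left have a
    similar lowest coefficient.  Comparing lowest coefficients
    ([asm_det_limit]) gives the number of matrices as a power of 3 times the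
    Hankel determinant of the a_(i+j+1), and the coefficients of the series
    (1 - (1 - 9 x)^(1/3)) / (3 x) are 3 (-9)^k a_(k+1). *)

Set Implicit Arguments.
Unset Strict Implicit.
Unset Printing Implicit Defensive.

Import Order.TTheory GRing.Theory Num.Theory.
Local Open Scope ring_scope.

(** * The lattice model and the exchange of two rows *)

Lemma sum_tuple_nil (R : nmodType) (T : finType) (F : seq T -> R) :
  \sum_(U : 0.-tuple T) F U = F [::].
Proof.
rewrite (big_pred1 [tuple]) //= => U; symmetry.
by apply/eqP/val_inj; rewrite [val U]size0nil // size_tuple.
Qed.

Lemma sum_tuple_cons (R : nmodType) (T : finType) n (F : seq T -> R) :
  \sum_(U : n.+1.-tuple T) F U =
  \sum_(b : T) \sum_(U : n.-tuple T) F (b :: U).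
Proof.
rewrite pair_bigA /= (reindex (fun p : T * n.-tuple T => cons_tuple p.1 p.2)) //=.
exists (fun U => (thead U, behead_tuple U)) => [[b U] _ | U _] /=.
  by congr pair; apply: val_inj.
by rewrite [RHS]tuple_eta; apply: val_inj.
Qed.

Section Lattice.

Variables (R : comNzRingType) (P : Type).
Variable w : P -> P -> bool -> bool -> bool -> bool -> R.

(** The vertex function [w x y h v h' v'] takes the bits on the left and upper
    edges, then those on the right and lower edges.  [row_weight] sums over the
    inner horizontal edges of one row, from the bit [h] on its left to [h'] on
    its right, with [S] above and [T] below. *)
Fixpoint row_weight x ys h S h' T : R :=
  match ys, S, T with
  | [::], [::], [::] => (h == h')%:R
  | y :: ys', s :: S', t :: T' =>
      \sum_(k : bool) w x y h s k t * row_weight x ys' k S' h' T'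
  | _, _, _ => 0
  end.

(** The domain-wall boundary is built in: each row runs from 0 to 1, and all
    bits below the last row are 1. *)
Fixpoint grid_sum xs ys S : R :=
  if xs is x :: xs' then
    \sum_(T : (size ys).-tuple bool)
      row_weight x ys false S true T * grid_sum xs' ys T
  else (S == nseq (size ys) true)%:R.

Definition double_row x1 x2 ys (h : bool * bool) S (h' : bool * bool) T : R :=
  \sum_(U : (size ys).-tuple bool)
     row_weight x1 ys h.1 S h'.1 U * row_weight x2 ys h.2 U h'.2 T.

(** The transfer matrix of two superposed vertices, indexed by pairs of
    horizontal bits. *)
Definition double_vertex x1 x2 y s t (h k : bool * bool) : R :=
  \sum_(u : bool) w x1 y h.1 s k.1 u * w x2 y h.2 u k.2 t.

Lemma double_row_cons x1 x2 y ys h s S h' t T :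
  double_row x1 x2 (y :: ys) h (s :: S) h' (t :: T) =
  \sum_k double_vertex x1 x2 y s t h k * double_row x1 x2 ys k S h' T.
Proof.
rewrite /double_row (sum_tuple_cons _ (fun U => row_weight x1 (y :: ys) h.1 (s :: S) h'.1 U *
   row_weight x2 (y :: ys) h.2 U h'.2 (t :: T))) /=.
transitivity (\sum_(u : bool) \sum_(U : (size ys).-tuple bool) \sum_k
   (w x1 y h.1 s k.1 u * w x2 y h.2 u k.2 t) *
   (row_weight x1 ys k.1 S h'.1 U * row_weight x2 ys k.2 U h'.2 T)).
  apply: eq_bigr => u _; apply: eq_bigr => U _.
  rewrite big_distrlr pair_bigA /=.
  by apply: eq_bigr => k _; rewrite mulrACA.
under [LHS]eq_bigr do rewrite exchange_big /=.
rewrite exchange_big /=; apply: eq_bigr => k _.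
rewrite /double_vertex mulr_suml; apply: eq_bigr => u _.
by rewrite mulr_sumr.
Qed.

Lemma row_weight_size_top x ys h S h' T :
  size S != size ys -> row_weight x ys h S h' T = 0.
Proof.
elim: ys h S T => [|y ys IH] h [|s S] [|t T] //=; rewrite eqSS => neq.
by rewrite big1 // => k _; rewrite IH ?mulr0.
Qed.

Variables (x1 x2 : P) (X : bool * bool -> bool * bool -> R).
Hypothesis YBE : forall y s t h h',
  \sum_k X h k * double_vertex x1 x2 y s t k h' =
  \sum_k double_vertex x2 x1 y s t h k * X k h'.

(** The railroad argument: a crossing that satisfies the Yang-Baxter equation
    at a single column can be moved through a double row one column at a time,
    exchanging the two row parameters. *)
Lemma double_row_exchange ys S T h h' :
  size S = size ys -> size T = size ys ->
  \sum_k X h k * double_row x1 x2 ys k S h' T =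
  \sum_k double_row x2 x1 ys h S k T * X k h'.
Proof.
elim: ys S T h => [|y ys IH] [|s S] [|t T] h //=.
  have double_row_nil a b (k k' : bool * bool) :
     double_row a b [::] k [::] k' [::] = (k == k')%:R.
    rewrite /double_row (sum_tuple_nil (fun U => row_weight a [::] k.1 [::] k'.1 U *
      row_weight b [::] k.2 U k'.2 [::])) /= -natrM mulnb.
    by case: k k' => [? ?] [? ?].
  move=> _ _; rewrite (bigD1 h') //= [RHS](bigD1 h) //= !double_row_nil !eqxx mulr1 mul1r.
  rewrite !big1 // => k nk; rewrite double_row_nil; first by rewrite eq_sym (negPf nk) mul0r.
  by rewrite (negPf nk) mulr0.
case=> sS [sT].
transitivity (\sum_l (\sum_k X h k * double_vertex x1 x2 y s t k l) * double_row x1 x2 ys l S h' T).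
  under [LHS]eq_bigr do rewrite double_row_cons mulr_sumr.
  rewrite exchange_big; apply: eq_bigr => l _.
  by rewrite mulr_suml; apply: eq_bigr => k _; rewrite mulrA.
under [LHS]eq_bigr do rewrite YBE mulr_suml.
rewrite exchange_big /=.
transitivity (\sum_k double_vertex x2 x1 y s t h k * \sum_l X k l * double_row x1 x2 ys l S h' T).
  by apply: eq_bigr => k _; rewrite mulr_sumr; apply: eq_bigr => l _; rewrite mulrA.
under [LHS]eq_bigr do rewrite IH // mulr_sumr.
rewrite exchange_big; apply: eq_bigr => l _.
by rewrite double_row_cons mulr_suml; apply: eq_bigr => k _; rewrite mulrA.
Qed.

End Lattice.

(** * Weights at a cube root of unity *)

Section Weights.

Variables (R : comNzRingType) (w : R).
Hypothesis w_root : w ^+ 2 + w + 1 = 0.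

(** The symmetric gauge would give sqrt (x y) in place of the factors x and y of
    the entries 1 and -1; as every row and every column has one more 1
    than -1, this changes a partition function only by square roots of the
    parameters, and makes every weight a polynomial. *)
Definition weight (x y : R) (h v h' v' : bool) : R :=
 match h, v, h', v' with
 | false, false, false, false | true, true, true, true => w * x - w ^+ 2 * y
 | false, true, false, true | true, false, true, false => w * y - w ^+ 2 * x
 | false, false, true, true => (w - w ^+ 2) * x
 | true, true, false, false => (w - w ^+ 2) * y
 | _, _, _, _ => 0
 end.

(** The intertwiner is determined up to a scalar by the equation of
    [yang_baxter], which is linear in it. *)
Definition crossing (x1 x2 : R) (h k : bool * bool) : R :=
 match h, k with
 | (false, false), (false, false) | (true, true), (true, true) =>
    w * x1 - w ^+ 2 * x2
 | (false, true), (false, true) => (w - w ^+ 2) * x2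
 | (true, false), (true, false) => (w - w ^+ 2) * x1
 | (false, true), (true, false) | (true, false), (false, true) => x2 - x1
 | _, _ => 0
 end.

Lemma sum_bool2 (F : bool * bool -> R) :
  \sum_k F k = F (true, true) + F (true, false) + (F (false, true) + F (false, false)).
Proof.
transitivity (\sum_a \sum_b F (a, b)); last by rewrite !big_bool.
by rewrite pair_bigA; apply: eq_bigr => -[].
Qed.

(** A finite check: 64 choices of the outer edges, each a polynomial identity
    modulo w^2 + w + 1. *)
Lemma yang_baxter x1 x2 y s t h h' :
  \sum_k crossing x1 x2 h k * double_vertex weight x1 x2 y s t k h' =
  \sum_k double_vertex weight x2 x1 y s t h k * crossing x1 x2 k h'.
Proof.
have w2 : w ^+ 2 = - w - 1 by rewrite -[LHS]subr0 -w_root; ring.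
rewrite !sum_bool2 /double_vertex !big_bool /=.
case: s t h h' => [] [] [[] []] [[] []] /=; rewrite ?(mul0r, mulr0, add0r, addr0) //.
all: ring: w2.
Qed.

End Weights.

Section LatticeRows.

Variables (R : comNzRingType) (P : Type).
Variable w : P -> P -> bool -> bool -> bool -> bool -> R.
Lemma grid_sum_double_row x1 x2 xs ys S :
  grid_sum w (x1 :: x2 :: xs) ys S =
  \sum_(T : (size ys).-tuple bool)
    double_row w x1 x2 ys (false, false) S (true, true) T * grid_sum w xs ys T.
Proof.
rewrite /= /double_row; under eq_bigr do rewrite mulr_sumr.
rewrite exchange_big; apply: eq_bigr => T _.
by rewrite mulr_suml; apply: eq_bigr => U _; rewrite mulrA.
Qed.

Lemma grid_sum_size x xs ys S : size S != size ys -> grid_sum w (x :: xs) ys S = 0.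
Proof. by move=> neq; rewrite /= big1 // => T _; rewrite row_weight_size_top ?mul0r. Qed.

End LatticeRows.

Section WeightedLattice.

Variables (R : idomainType) (w : R).
Hypothesis w_root : w ^+ 2 + w + 1 = 0.
Local Notation grid_sum := (grid_sum (weight w)).
Local Notation row_weight := (row_weight (weight w)).
Local Notation alpha x y := (w * x - w ^+ 2 * y).
Local Notation beta x y := (w * y - w ^+ 2 * x).

(** On the domain-wall boundary both crossings are the same scalar
    [alpha x1 x2], which cancels. *)
Lemma grid_sum_swap x1 x2 xs ys S : alpha x1 x2 != 0 ->
  grid_sum (x1 :: x2 :: xs) ys S = grid_sum (x2 :: x1 :: xs) ys S.
Proof.
move=> a_neq0.
have [sS | neq] := eqVneq (size S) (size ys); last by rewrite !grid_sum_size.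
rewrite !grid_sum_double_row; apply: eq_bigr => T _; congr (_ * _); apply: (mulfI a_neq0).
have := @double_row_exchange _ _ (weight w) x1 x2 (crossing w x1 x2)
  (yang_baxter w_root x1 x2) ys S T (false, false) (true, true) sS (size_tuple T).
by rewrite !sum_bool2 /= !(mul0r, mulr0, add0r, addr0) => ->; rewrite mulrC.
Qed.

Lemma grid_sum_perm xs xs' ys S :
  {in xs &, forall x x', alpha x x' != 0} ->
  perm_eq xs xs' -> grid_sum xs ys S = grid_sum xs' ys S.
Proof.
move=> a_neq0; elim: xs xs' S a_neq0 => [|x xs IH] xs' S a_neq0 eq_xs.
  by move/perm_size: eq_xs => /esym/size0nil ->.
have x_xs' : x \in xs' by rewrite -(perm_mem eq_xs) mem_head.
case/splitPr: x_xs' eq_xs => p q eq_xs.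
have {}eq_xs : perm_eq xs (p ++ q).
  by rewrite -(perm_cons x) (perm_trans eq_xs) // (perm_catCA p [:: x] q).
have a_neq0' : {in xs &, forall x x', alpha x x' != 0}.
  by move=> y z ys' zs; apply: a_neq0; rewrite inE ?ys' ?zs orbT.
transitivity (grid_sum (x :: p ++ q) ys S).
  by rewrite /=; apply: eq_bigr => T _; rewrite (IH _ _ a_neq0' eq_xs).
have {}a_neq0 : {in p, forall y, alpha x y != 0}.
  by move=> y yp; apply: a_neq0; rewrite inE ?eqxx // (perm_mem eq_xs) mem_cat yp orbT.
elim: p S {eq_xs IH a_neq0'} a_neq0 => [//|y p IH] S a_neq0 /=.
rewrite -[LHS]/(grid_sum (x :: y :: p ++ q) ys S) grid_sum_swap; last by apply: a_neq0; rewrite mem_head.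
by rewrite /=; apply: eq_bigr => T _; rewrite -IH // => z zp; apply: a_neq0; rewrite inE zp orbT.
Qed.

(** Once the entry 1 of the first column has been met, the rest of that column
    is zero, and it does not interact with the other columns. *)
Lemma grid_sum_column_closed xs y ys S :
  grid_sum xs (y :: ys) (true :: S) = (\prod_(x <- xs) beta x y) * grid_sum xs ys S.
Proof.
elim: xs S => [|x xs IH] S /=; first by rewrite big_nil mul1r eqseq_cons.
rewrite (sum_tuple_cons _ (fun T => row_weight x (y :: ys) false (true :: S) true T
   * grid_sum xs (y :: ys) T)) big_bool /= [X in _ + X]big1 => [|T _]; last first.
  by rewrite big_bool /= !mul0r addr0 mul0r.
rewrite addr0 big_cons mulr_sumr; apply: eq_bigr => T _.
by rewrite big_bool /= IH; ring.
Qed.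

Lemma grid_sum_column_open x xs y ys S :
  grid_sum (x :: xs) (y :: ys) (false :: S) =
  (w - w ^+ 2) * x * (\prod_(x' <- xs) beta x' y) *
  \sum_(T : (size ys).-tuple bool) row_weight x ys true S true T * grid_sum xs ys T
  + alpha x y * \sum_(T : (size ys).-tuple bool)
     row_weight x ys false S true T * grid_sum xs (y :: ys) (false :: T).
Proof.
rewrite /= (sum_tuple_cons _ (fun T => row_weight x (y :: ys) false (false :: S) true T
   * grid_sum xs (y :: ys) T)) big_bool.
rewrite !mulr_sumr; congr (_ + _); apply: eq_bigr => T _; rewrite /= big_bool /=.
  by rewrite grid_sum_column_closed; ring.
by rewrite mul0r add0r mulrA.
Qed.

(** A row entered by 1 under a zero boundary cannot use an entry 1, nor an
    entry -1, so all its entries are zero. *)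
Lemma row_weight_frozen x ys T :
  row_weight x ys true (nseq (size ys) false) true T =
  (\prod_(y <- ys) beta x y) * (T == nseq (size ys) false)%:R.
Proof.
elim: ys T => [|y ys IH] [|t T] /=; rewrite ?big_nil ?mul1r ?mulr0 //.
rewrite big_bool big_cons eqseq_cons; case: t => /=.
  by rewrite !mul0r addr0 mulr0.
by rewrite IH mul0r addr0 mulrA.
Qed.

(** The weight [alpha x y] is that of a zero in the corner; when it vanishes the
    corner entry must be 1, and the first row and column are frozen. *)
Lemma grid_sum_corner x xs y ys : alpha x y = 0 ->
  grid_sum (x :: xs) (y :: ys) (nseq (size (y :: ys)) false) =
  (w - w ^+ 2) * x * (\prod_(x' <- xs) beta x' y) * (\prod_(y' <- ys) beta x y')
  * grid_sum xs ys (nseq (size ys) false).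
Proof.
move=> a0; rewrite [nseq _ _]/= grid_sum_column_open a0 mul0r addr0 -[RHS]mulrA; congr (_ * _).
rewrite (bigD1 (nseq_tuple (size ys) false)) //= big1 => [|T neq].
 by rewrite row_weight_frozen eqxx mulr1 addr0.
rewrite row_weight_frozen -[nseq _ _]/(val (nseq_tuple (size ys) false)).
by rewrite (inj_eq val_inj) (negPf neq) mulr0 mul0r.
Qed.

(** The first column contains a single 1, whose weight does not involve [y], and
    all its other vertices have a weight of degree one in [y]; hence the degree
    is less than the number of rows. *)
Lemma grid_sum_column_poly xs ys S : exists2 p : {poly R},
  (size p <= size xs)%N & forall y, p.[y] = grid_sum xs (y :: ys) (false :: S).
Proof.
elim: xs S => [|x xs IH] S.
  by exists 0; rewrite ?size_poly0 // => y; rewrite horner0.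
have /fin_all_exists2 [p size_p pE] : forall T : (size ys).-tuple bool, exists2 p : {poly R},
  (size p <= size xs)%N & forall y, p.[y] = grid_sum xs (y :: ys) (false :: T).
  by move=> T; apply: IH.
pose c (T : (size ys).-tuple bool) := row_weight x ys false S true T.
exists (((w - w ^+ 2) * x * \sum_(T : (size ys).-tuple bool) row_weight x ys true S true T * grid_sum xs ys T)
        *: (\prod_(x' <- xs) (w *: 'X - (w ^+ 2 * x')%:P))
       + ((w * x)%:P - w ^+ 2 *: 'X) * \sum_T c T *: p T).
  apply: (leq_trans (size_polyD _ _)); rewrite geq_max; apply/andP; split.
    apply: (leq_trans (size_scale_leq _ _)).
    elim: (xs) => [|x' s IHs]; first by rewrite big_nil size_poly1.
    rewrite big_cons (leq_trans (size_polyMleq _ _)) //.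
    have szl : (size (w *: 'X - (w ^+ 2 * x')%:P)%R <= 2)%N.
      rewrite (leq_trans (size_polyD _ _)) // size_polyN geq_max.
      by rewrite (leq_trans (size_scale_leq _ _)) ?size_polyX //= (leq_trans (size_polyC_leq1 _)).
    by move: (leq_add szl IHs); rewrite -ltnS; case: (_ + _)%N.
  apply: (leq_trans (size_polyMleq _ _)).
  have szl : (size ((w * x)%:P - w ^+ 2 *: 'X)%R <= 2)%N.
    rewrite (leq_trans (size_polyD _ _)) // size_polyN geq_max.
    by rewrite (leq_trans (size_polyC_leq1 _)) //= (leq_trans (size_scale_leq _ _)) ?size_polyX.
  have szr : (size (\sum_T c T *: p T)%R <= size xs)%N.
    apply: (leq_trans (size_sum _ _ _)); apply/bigmax_leqP => T _.
    by rewrite (leq_trans (size_scale_leq _ _)).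
  by move: (leq_add szl szr); rewrite -ltnS; case: (_ + _)%N.
move=> y; rewrite grid_sum_column_open !hornerE horner_prod horner_sum.
rewrite mulrAC; congr (_ * _ * _ + _ * _).
  by apply: eq_bigr => i _; rewrite !hornerE.
by apply: eq_bigr => T _; rewrite !hornerE pE.
Qed.

End WeightedLattice.

(** * Vandermonde matrices and the cleared Cauchy-like matrix *)

Definition tail (T : Type) n (x : 'I_n.+1 -> T) : 'I_n -> T :=
  fun i => x (lift ord0 i).

Section Determinants.

Variable R : comNzRingType.

Definition vdm n (x : 'I_n -> R) := \det (Vandermonde n (\row_i x i)).

Lemma vdmS n (x : 'I_n.+1 -> R) :
  vdm x = (\prod_j (x (lift ord0 j) - x ord0)) * vdm (tail x).
Proof.
rewrite /vdm !det_Vandermonde big_ord_recl /=; congr (_ * _).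
  by rewrite big_mkcond big_ord_recl /= mul1r; apply: eq_bigr => i _; rewrite !mxE.
apply: eq_bigr => i _; rewrite big_mkcond big_ord_recl /= mul1r [RHS]big_mkcond /=.
by apply: eq_bigr => j _; rewrite !mxE.
Qed.

Lemma vdm_perm n (x : 'I_n -> R) (s : 'S_n) :
  vdm (fun i => x (s i)) = (-1) ^+ s * vdm x.
Proof.
rewrite /vdm -(det_tr (Vandermonde n (\row_i x (s i)))) -(det_tr (Vandermonde _ _)).
rewrite -det_perm -det_mulmx -row_permE; congr (\det _).
by apply/matrixP => i j; rewrite !mxE.
Qed.

Definition qform (x y : R) := x ^+ 2 + x * y + y ^+ 2.

(** The matrix of the 1 / [qform (x i) (y j)] with row i multiplied by the
    product of its denominators, so that it makes sense over any ring. *)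
Definition cleared_mx n (x y : 'I_n -> R) : 'M_n :=
  \matrix_(i, j) \prod_(k | k != j) qform (x i) (y k).

Lemma cleared_mx_perm n (x y : 'I_n -> R) (s : 'S_n) :
  \det (cleared_mx (fun i => x (s i)) y) = (-1) ^+ s * \det (cleared_mx x y).
Proof.
rewrite -det_perm -det_mulmx -row_permE; congr (\det _).
by apply/matrixP => i j; rewrite !mxE.
Qed.

(** When the first denominator vanishes, the first row is zero outside the
    diagonal; this mirrors the frozen corner of the lattice sum. *)
Lemma cleared_mx_corner n (x y : 'I_n.+1 -> R) :
  qform (x ord0) (y ord0) = 0 ->
  \det (cleared_mx x y) =
  (\prod_j (qform (x (lift ord0 j)) (y ord0) * qform (x ord0) (y (lift ord0 j))))
  * \det (cleared_mx (tail x) (tail y)).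
Proof.
move=> q0; rewrite (expand_det_row _ ord0) big_ord_recl big1 ?addr0 => [|j _]; last first.
  by rewrite mxE (bigD1 ord0) //= q0 !mul0r.
have -> : cleared_mx x y ord0 ord0 = \prod_j qform (x ord0) (y (lift ord0 j)).
  by rewrite mxE big_mkcond big_ord_recl /= mul1r.
suff -> : cofactor (cleared_mx x y) ord0 ord0 =
    (\prod_j qform (x (lift ord0 j)) (y ord0)) *
    \det (cleared_mx (tail x) (tail y)).
  by rewrite big_split /=; ring.
rewrite /cofactor addn0 expr0 mul1r.
set D := \prod_i _; have -> : D = \det (diag_mx (\row_j qform (x (lift ord0 j)) (y ord0))).
  by rewrite det_diag; apply: eq_bigr => i _; rewrite mxE.
rewrite -det_mulmx mul_diag_mx; congr (\det _).
apply/matrixP => i j; rewrite !mxE big_mkcond big_ord_recl /=; congr (_ * _).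
by rewrite [RHS]big_mkcond; apply: eq_bigr => k _; rewrite (inj_eq lift_inj).
Qed.

End Determinants.

Lemma cleared_mx_map (R S : comNzRingType) (f : {rmorphism R -> S}) n (x y : 'I_n -> R) :
  map_mx f (cleared_mx x y) = cleared_mx (f \o x) (f \o y).
Proof.
apply/matrixP => i j; rewrite !mxE rmorph_prod; apply: eq_bigr => k _.
by rewrite /qform !rmorphD !rmorphXn rmorphM.
Qed.

Lemma eq_cleared_mx (R : comNzRingType) n (x x' y y' : 'I_n -> R) :
  x =1 x' -> y =1 y' -> cleared_mx x y = cleared_mx x' y'.
Proof.
move=> eqx eqy; apply/matrixP => i j; rewrite !mxE.
by apply: eq_bigr => k _; rewrite eqx eqy.
Qed.

Lemma size_prod_leq (R : nzRingType) (I : finType) (P : pred I) (F : I -> {poly R}) (d : I -> nat) :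
  (forall i, P i -> (size (F i) <= (d i).+1)%N) ->
  (size (\prod_(i | P i) F i)%R <= (\sum_(i | P i) d i).+1)%N.
Proof.
move=> sz; elim/big_rec2: _ => [|i n p Pi IH]; first by rewrite size_poly1.
rewrite (leq_trans (size_polyMleq _ _)) //.
by move: (leq_add (sz _ Pi) IH); rewrite addSn addnS -ltnS; case: (_ + _)%N.
Qed.

Lemma size_det_leq (R : comNzRingType) n (M : 'M[{poly R}]_n) (d : 'I_n -> nat) :
  (forall i j, (size (M i j) <= (d j).+1)%N) ->
  (size (\det M) <= (\sum_j d j).+1)%N.
Proof.
move=> sz; apply: (leq_trans (size_sum _ _ _)); apply/bigmax_leqP => s _.
rewrite -polyC1 -polyCN -rmorphXn /= mul_polyC (leq_trans (size_scale_leq _ _)) //.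
have -> : (\sum_j d j = \sum_i d (s i))%N by rewrite (reindex_inj (@perm_inj _ s)).
exact: size_prod_leq.
Qed.

(** The variable of the first column is absent from column 0 and occurs with
    degree two in each of the n other columns, so the degree is at most 2n. *)
Lemma size_det_cleared (R : comNzRingType) n (x : 'I_n.+1 -> R) (y : 'I_n.+1 -> R) :
  (size (\det (cleared_mx (fun i => (x i)%:P)
      (fun k => if k == ord0 then 'X else (y k)%:P))) <= n.*2.+1)%N.
Proof.
have -> : (n.*2 = \sum_(j < n.+1) \sum_(k < n.+1 | k != j) (k == ord0).*2)%N.
  rewrite big_ord_recl big1 => [|k]; last by case: (k == ord0).
  rewrite (eq_bigr (fun=> 2)) ?sum_nat_const ?card_ord ?muln2 // => i _.
  by rewrite big_mkcond big_ord_recl big1 //= => k _; case: ifP.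
apply: size_det_leq => i j; rewrite mxE; apply: size_prod_leq => k _.
have szC : forall c : R, (size c%:P <= 3)%N by move=> c; rewrite (leq_trans (size_polyC_leq1 _)).
case: (k == ord0); rewrite /qform; last first.
  by rewrite -!rmorphXn -rmorphM -!rmorphD /= size_polyC_leq1.
rewrite (leq_trans (size_polyD _ _)) // geq_max size_polyXn andbT.
rewrite (leq_trans (size_polyD _ _)) // geq_max -rmorphXn szC mul_polyC.
by rewrite (leq_trans (size_scale_leq _ _)) ?size_polyX.
Qed.

(** * The Izergin-Korepin determinant *)

Section IzerginKorepin.

Variables (R : idomainType) (w : R).
Hypothesis w_root : w ^+ 2 + w + 1 = 0.
Local Notation alpha x y := (w * x - w ^+ 2 * y).
Local Notation beta x y := (w * y - w ^+ 2 * x).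

Definition domain_wall n (x y : 'I_n -> R) :=
  grid_sum (weight w) [seq x i | i <- enum 'I_n] [seq y i | i <- enum 'I_n] (nseq n false).

Definition izergin_korepin n (x y : 'I_n -> R) :=
  (-1) ^+ 'C(n, 2) * domain_wall x y * vdm x * vdm y =
  (w - w ^+ 2) ^+ n * (\prod_i x i) * \det (cleared_mx x y).

Let w2 : w ^+ 2 = - w - 1.
Proof. by rewrite -[LHS]subr0 -w_root; ring. Qed.

Let w3 : w ^+ 3 = 1.
Proof. by ring: w2. Qed.

(** The denominators of the determinant are the products of the two weights of
    zero entries. *)
Lemma qformE x y : qform x y = - (alpha x y * beta x y).
Proof. by rewrite /qform; ring: w2. Qed.

Lemma map_enum_ordS (T : Type) n (x : 'I_n.+1 -> T) :
  [seq x i | i <- enum 'I_n.+1] = x ord0 :: [seq x (lift ord0 i) | i <- enum 'I_n].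
Proof. by rewrite enum_ordSl map_cons -map_comp. Qed.

Lemma domain_wall_corner n (x y : 'I_n.+1 -> R) : alpha (x ord0) (y ord0) = 0 ->
  domain_wall x y = (w - w ^+ 2) * x ord0 *
   (\prod_j (beta (x (lift ord0 j)) (y ord0) * beta (x ord0) (y (lift ord0 j)))) *
   domain_wall (tail x) (tail y).
Proof.
move=> a0; pose xs := [seq x (lift ord0 i) | i <- enum 'I_n].
pose ys := [seq y (lift ord0 i) | i <- enum 'I_n].
have size_ys : size ys = n by rewrite size_map size_enum_ord.
have -> : domain_wall x y = grid_sum (weight w) (x ord0 :: xs) (y ord0 :: ys)
    (nseq (size (y ord0 :: ys)) false).
  by rewrite /domain_wall !map_enum_ordS [size _]/= size_ys.
rewrite grid_sum_corner // size_ys /xs /ys.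
have prodE (F : R -> R) (z : 'I_n.+1 -> R) :
  \prod_(t <- [seq z (lift ord0 i) | i <- enum 'I_n]) F t = \prod_i F (z (lift ord0 i)).
  by rewrite big_map big_enum.
by rewrite (prodE (fun t => beta t _)) (prodE (fun t => beta _ t)) big_split /= !mulrA.
Qed.

Lemma izergin_korepin_corner n (x y : 'I_n.+1 -> R) : alpha (x ord0) (y ord0) = 0 ->
  izergin_korepin (tail x) (tail y) -> izergin_korepin x y.
Proof.
rewrite /izergin_korepin => a0 IK.
rewrite domain_wall_corner // !vdmS cleared_mx_corner ?qformE ?a0 ?mul0r ?oppr0 //.
have x0 : x ord0 = w * y ord0.
  have /eqP : w * (x ord0 - w * y ord0) = 0 by rewrite -a0; ring.
  rewrite mulf_eq0 subr_eq0 => /orP[/eqP w0|/eqP //].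
  by have := w3; rewrite w0 expr0n /= => /esym/eqP; rewrite oner_eq0.
rewrite binS bin1 exprD big_ord_recl.
set P := \prod_j (beta _ _ * _); set Q := \prod_j (qform _ _ * _).
have PQ : (-1) ^+ n * P * (\prod_j (x (lift ord0 j) - x ord0)) *
   (\prod_j (y (lift ord0 j) - y ord0)) = Q.
  rewrite -{1}(card_ord n) -prodr_const -!big_split /=; apply: eq_bigr => j _.
  by rewrite /qform x0; ring: w2.
have regroup (s sn th t a p X Y Z Vx Vy Px D : R) : s * Z * Vx * Vy = t * Px * D ->
    s * sn * (th * a * p * Z) * (X * Vx) * (Y * Vy) =
    th * t * (a * Px) * (sn * p * X * Y * D).
  move=> E; transitivity (th * a * (sn * p * X * Y) * (s * Z * Vx * Vy)); first by ring.
  by rewrite E; ring.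
by rewrite -PQ [_ ^+ n.+1]exprS; apply: regroup IK.
Qed.

(** The lattice sum is symmetric in the row parameters, and on both sides one
    determinant changes by the sign of the permutation. *)
Lemma izergin_korepin_perm n (x y : 'I_n -> R) (s : 'S_n) :
  (forall i j, alpha (x i) (x j) != 0) -> izergin_korepin (fun i => x (s i)) y -> izergin_korepin x y.
Proof.
move=> a_neq0; rewrite /izergin_korepin (vdm_perm x s) (cleared_mx_perm x y s).
have -> : domain_wall (fun i => x (s i)) y = domain_wall x y.
  apply: (grid_sum_perm w_root) => [_ _ /mapP[i _ ->] /mapP[j _ ->] //|].
  rewrite (map_comp x s); apply: perm_map; apply: uniq_perm.
  - by rewrite map_inj_uniq ?enum_uniq //; apply: perm_inj.
  - exact: enum_uniq.
  by move=> i; rewrite mem_enum inE; apply/mapP; exists (s^-1 i)%g;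
     rewrite ?mem_enum ?permKV.
have -> : \prod_i x (s i) = \prod_i x i by rewrite [RHS](reindex_inj (@perm_inj _ s)).
move=> eqs; apply: (mulfI (_ : (-1) ^+ s != 0 :> R)); first by rewrite signr_eq0.
have regroup (e a b c d : R) : e * (a * b * c * d) = a * b * (e * c) * d by ring.
by rewrite regroup eqs mulrCA.
Qed.

(** Both sides are polynomials of degree at most 2n in the parameter t of the
    first of the n + 1 columns.  They agree at 2n + 1 points: both vanish when t
    is the parameter of another column, and the frozen corner together with the
    symmetry in x gives the n + 1 points w^2 x_i. *)
Theorem izergin_korepin_formula n (x y : 'I_n -> R) :
  injective x -> injective y ->
  (forall i j, alpha (x i) (x j) != 0) -> (forall i j, y j != w ^+ 2 * x i) ->
  izergin_korepin x y.
Proof.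
elim: n x y => [|n IH] x y x_inj y_inj a_neq0 y_neq.
  rewrite /izergin_korepin /domain_wall /vdm !det_mx00 big_ord0 !expr0 (size0nil (size_enum_ord 0)) /=.
  by rewrite !mulr1.
pose yt t (k : 'I_n.+1) := if k == ord0 then t else y k.
pose y' j := y (lift ord0 j).
have vdmyt t : vdm (yt t) = (\prod_j (y' j - t)) * vdm y'.
  by rewrite vdmS.
have [pZ size_pZ pZE] : exists2 p : {poly R},
    (size p <= n.+1)%N & forall t, p.[t] = domain_wall x (yt t).
  have [p size_p pE] := grid_sum_column_poly w [seq x i | i <- enum 'I_n.+1]
    [seq y' i | i <- enum 'I_n] (nseq n false).
  exists p => [|t]; first by rewrite (leq_trans size_p) // size_map size_enum_ord.
  by rewrite pE /domain_wall !map_enum_ordS.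
pose L : {poly R} := (-1) ^+ 'C(n.+1, 2) *: (vdm x *: (vdm y' *: 
   (pZ * \prod_j ((y' j)%:P - 'X)))).
pose Q : {poly R} := ((w - w ^+ 2) ^+ n.+1 * \prod_i x i) *:
  \det (cleared_mx (fun i => (x i)%:P) (fun k => if k == ord0 then 'X else (y k)%:P)).
have LE t : L.[t] = (-1) ^+ 'C(n.+1, 2) * domain_wall x (yt t) * vdm x * vdm (yt t).
  rewrite !hornerZ hornerM pZE vdmyt horner_prod.
  rewrite (eq_bigr (fun j => y' j - t)) => [|j _]; last by rewrite !hornerE.
  have regroup (a b c d e : R) : a * (b * (c * (d * e))) = a * d * b * (e * c) by ring.
  exact: regroup.
have QE t : Q.[t] = (w - w ^+ 2) ^+ n.+1 * (\prod_i x i) * \det (cleared_mx x (yt t)).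
  rewrite hornerZ; congr (_ * _).
  rewrite -horner_evalE -det_map_mx cleared_mx_map; congr (\det _).
  apply: eq_cleared_mx => k /=; rewrite horner_evalE ?hornerC // /yt.
  by case: ifP => _; rewrite ?hornerX ?hornerC.
have QL0 : Q - L = 0.
  (* n points where two columns have the same parameter, then n + 1 points where
     the weight of a zero in the corner of row i vanishes *)
  pose rs := [seq y' j | j <- enum 'I_n] ++ [seq w ^+ 2 * x i | i <- enum 'I_n.+1].
  apply: (@roots_geq_poly_eq0 _ _ rs).
  - apply/allP => t; rewrite mem_cat /root hornerD hornerN subr_eq0 => /orP[]/mapP[i _ tE].
      rewrite LE vdmyt (bigD1 i) //= tE subrr !(mul0r, mulr0) QE.
      rewrite -(det_tr (cleared_mx _ _)) (@determinant_alternate _ _ _ ord0 (lift ord0 i)) ?mulr0 //.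
      move=> k; rewrite !mxE.
      rewrite (bigD1 (lift ord0 i)) //= [RHS](bigD1 ord0) //=; congr (_ * _).
      by apply: eq_bigl => l; rewrite andbC.
    apply/eqP; rewrite LE QE; apply/esym.
    apply: (@izergin_korepin_perm _ _ _ (tperm ord0 i)) => //; apply: izergin_korepin_corner.
      rewrite tpermL /yt /= tE; have -> : w ^+ 2 * (w ^+ 2 * x i) = w ^+ 3 * (w * x i) by ring.
      by rewrite w3; ring.
    apply: IH => //.
    + by move=> j k /x_inj/perm_inj/lift_inj.
    + by move=> j k; rewrite /yt /= => /y_inj/lift_inj.
    + by move=> j k; apply: a_neq0.
    by move=> j k; rewrite /tail /yt /=.
  - have w2_neq0 : w ^+ 2 != 0.
      by rewrite expf_eq0 /=; apply: contra_eq_neq w3 => ->; rewrite expr0n /= eq_sym oner_neq0.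
    rewrite /rs cat_uniq map_inj_uniq ?enum_uniq => [|i j /y_inj/lift_inj //].
    rewrite map_inj_uniq ?enum_uniq ?andbT => [|i j /(mulfI w2_neq0)/x_inj //].
    apply/hasPn => _ /mapP[i _ ->]; apply/mapP => -[j _ /esym/eqP].
    by rewrite (negPf (y_neq _ _)).
  rewrite /rs size_cat size_map size_enum_ord size_map size_enum_ord (leq_trans (size_polyD _ _)) // size_polyN geq_max.
  rewrite addnS addnn (leq_trans (size_scale_leq _ _)) ?size_det_cleared //=.
  do 3!rewrite (leq_trans (size_scale_leq _ _)) //.
  rewrite (leq_trans (size_polyMleq _ _)) //.
  have szp : (size (\prod_j ((y' j)%:P - 'X))%R <= n.+1)%N.
    have := @size_prod_leq _ _ predT (fun j => (y' j)%:P - 'X) (fun=> 1).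
    rewrite sum1_card card_ord; apply=> j _.
    rewrite (leq_trans (size_polyD _ _)) // size_polyN size_polyX geq_max andbT.
    by rewrite (leq_trans (size_polyC_leq1 _)).
  by move: (leq_add size_pZ szp); rewrite addSn addnS addnn -ltnS; case: (_ + _)%N.
have yt0 : yt (y ord0) =1 y by move=> k; rewrite /yt; case: eqP => [->|].
have : Q.[y ord0] = L.[y ord0] by apply/eqP; rewrite -subr_eq0 -hornerN -hornerD QL0 horner0.
rewrite QE LE /izergin_korepin (eq_cleared_mx (frefl x) yt0) => ->.
rewrite /domain_wall (eq_map yt0) /vdm; congr (_ * \det (Vandermonde _ _)).
by apply/matrixP => i j; rewrite !mxE yt0.
Qed.

End IzerginKorepin.

(** * Alternating sign matrices as lattice configurations *)

(** [h] is the partial sum before the entry [a]: [fits] says that the next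
    partial sum is again 0 or 1, and then [next_sum] is that sum. *)
Definition fits (h : bool) (a : int) : bool :=
  [|| a == 0, (a == 1) && ~~ h | (a == -1) && h].
Definition next_sum (h : bool) (a : int) : bool := h (+) (a != 0).

Fixpoint sums01 (h : bool) (s : seq int) : bool :=
  if s is a :: s' then fits h a && sums01 (next_sum h a) s' else h.

Definition opposite_signs (x y : int) := x * y < 0.
Definition nonzero (s : seq int) := [seq x <- s | x != 0].

Lemma sums01E h s : all (mem [:: 0; 1; -1 : int]) s ->
  sums01 h s = path opposite_signs (if h then 1 else -1) (nonzero s) &&
               (\sum_(a <- s) a == if h then 0 else 1).
Proof.
elim: s h => [|a s IH] h; first by rewrite big_nil; case: h.
rewrite [all _ _]/= big_cons => /andP[]; rewrite !inE => /or3P[] /eqP -> /IH E;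
  rewrite /= /fits /next_sum /= E.
- by rewrite add0r addbF.
- by case: h => //=; congr (_ && _); lia.
by case: h; rewrite ?andbF //=; congr (_ && _); lia.
Qed.

(** Terms of alternating signs cancel in pairs. *)
Lemma alternating_sum (b : bool) s : all (mem [:: 0; 1; -1 : int]) s ->
  path opposite_signs (if b then 1 else -1) (nonzero s) ->
  \sum_(a <- s) a = 0 \/ \sum_(a <- s) a = if b then -1 else 1.
Proof.
elim: s b => [|a s IH] b /=; first by rewrite big_nil; left.
rewrite big_cons => /andP[]; rewrite !inE => /or3P[] /eqP -> /= alls.
- by rewrite add0r; apply: IH.
- by case: b => //= /(IH true alls) /= []->; [right | left].
- by case: b => //= /(IH false alls) /= []->; [right | left].
Qed.

(** The alternation together with the sum 1 forces the first nonzero entry to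
    be 1: otherwise the remaining nonzero entries would alternate from 1 on and
    the total would be at most 0. *)
Lemma sums01_alternating s : all (mem [:: 0; 1; -1 : int]) s ->
  sums01 false s = (\sum_(a <- s) a == 1) && alternating s.
Proof.
move=> alls; rewrite sums01E //= andbC; case: eqP => //= sum1.
rewrite /alternating -[sorted _ _]/(sorted opposite_signs (nonzero s)).
apply/idP/idP; first by apply: path_sorted.
elim: s alls sum1 => [//|a s IH] /andP[].
rewrite big_cons !inE => /or3P[] /eqP -> alls.
- by rewrite add0r; apply: IH.
- by [].
by move=> sum1 /= /(@alternating_sum false s alls)[] sum_s; move: sum1; rewrite sum_s.
Qed.

Lemma sum_entry (R : nmodType) (F : int -> R) :
  \sum_(a : asm_entry) F (val a) = F 0 + F 1 + F (-1).
Proof.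
rewrite -(big_map val xpredT F) (perm_big [:: 0; 1; -1]) /=.
  by rewrite !big_cons big_nil addr0 addrA.
apply: uniq_perm => //; first by rewrite map_inj_uniq ?index_enum_uniq //; apply: val_inj.
move=> a; apply/mapP/idP => [[b _ ->]|a_in]; first exact: valP b.
by exists (SeqSub a_in); rewrite ?mem_index_enum.
Qed.

Definition fits_row (S : seq bool) (r : seq int) : bool :=
  all (fun p => fits p.1 p.2) (zip S r).
Definition next_sums (S : seq bool) (r : seq int) : seq bool :=
  [seq next_sum p.1 p.2 | p <- zip S r].

Fixpoint columns01 (S : seq bool) (rows : seq (seq int)) : bool :=
  if rows is r :: rows' then fits_row S r && columns01 (next_sums S r) rows'
  else S == nseq (size S) true.

Lemma columns01P n S (rows : seq (seq int)) :
  size S = n -> all (fun r => size r == n) rows ->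
  columns01 S rows =
  [forall j : 'I_n, sums01 (nth false S j) [seq nth 0 r j | r <- rows]].
Proof.
elim: rows S => [|r rows IH] S sizeS /=.
  move=> _; rewrite sizeS; apply/eqP/forallP => [-> j|S1]; first by rewrite nth_nseq ltn_ord.
  apply: (@eq_from_nth _ false) => [|j]; rewrite ?size_nseq sizeS // => lt_j.
  by rewrite nth_nseq lt_j; apply: (S1 (Ordinal lt_j)).
case/andP=> /eqP size_r all_size.
have size_zip : size (zip S r) = n by rewrite size_zip sizeS size_r minnn.
have -> : fits_row S r = [forall j : 'I_n, fits (nth false S j) (nth 0 r j)].
  apply/(all_nthP (false, 0))/forallP => [fit j | fit j].
    by have := fit j; rewrite size_zip ltn_ord nth_zip ?sizeS ?size_r //; apply.
  by rewrite size_zip nth_zip ?sizeS ?size_r // => lt_j; apply: (fit (Ordinal lt_j)).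
rewrite IH ?size_map //; apply/andP/forallP => [[/forallP fit /forallP ok] j | ok].
  rewrite fit; have := ok j.
  by rewrite (nth_map (false, 0)) ?size_zip // nth_zip ?sizeS ?size_r.
split; apply/forallP => j; have /andP[//] := ok j.
by rewrite (nth_map (false, 0)) ?size_zip // nth_zip ?sizeS ?size_r.
Qed.

Section Count.

Variable R : comNzRingType.

(** The entry at a vertex is at once the jump of the row sum and that of the
    column sum. *)
Definition ice_rule (P : Type) (x y : P) (h v h' v' : bool) : R :=
  (h + v' == h' + v)%N%:R.

Lemma sum_rows_ice (P : Type) (x : P) (ys : seq P) n h (S T : seq bool) :
  size ys = n -> size S = n -> size T = n ->
  \sum_(r : n.-tuple asm_entry)
    [&& sums01 h (map val r), fits_row S (map val r) & next_sums S (map val r) == T]%:R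
  = row_weight (@ice_rule P) x ys h S true T.
Proof.
elim: ys n h S T => [|y ys IH] [|n] h [|s S] [|t T] //=.
  move=> _ _ _; rewrite (sum_tuple_nil (fun r : seq asm_entry => [&& sums01 h (map val r),
    fits_row [::] (map val r) & next_sums [::] (map val r) == [::]]%:R)) /= andbT.
  by case: h.
case=> size_ys [size_S] [size_T].
rewrite (sum_tuple_cons _ (fun r : seq asm_entry => [&& sums01 h (map val r),
    fits_row (s :: S) (map val r) & next_sums (s :: S) (map val r) == t :: T]%:R)) /=.
pose F a := [&& fits h a, fits s a & next_sum s a == t]%:R * row_weight (@ice_rule P) x ys (next_sum h a) S true T.
transitivity (\sum_(a : asm_entry) F (val a)).
  apply: eq_bigr => a _; rewrite /F -(IH n) // mulr_sumr; apply: eq_bigr => r _.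
  rewrite -natrM mulnb; congr (nat_of_bool _)%:R.
  rewrite /fits_row /next_sums /= eqseq_cons.
  by case: (fits h _) (fits s _) (next_sum s _ == t) => [] [] [] //=; rewrite ?andbF.
rewrite sum_entry big_bool /F /ice_rule {F}.
by case: h s t => [] [] []; rewrite /= /fits /next_sum /= ?mul0r ?mul1r ?add0r ?addr0.
Qed.

Lemma sum_matrices_ice (P : Type) (xs ys : seq P) n m S :
  size xs = m -> size ys = n -> size S = n ->
  \sum_(t : m.-tuple (n.-tuple asm_entry))
    (all (fun r : n.-tuple _ => sums01 false (map val r)) t &&
     columns01 S [seq map val (val r) | r <- t])%:R
  = grid_sum (@ice_rule P) xs ys S.
Proof.
elim: xs m S => [|x xs IH] [|m] S //=.
  move=> _ size_ys size_S; rewrite (sum_tuple_nil (fun t : seq (n.-tuple asm_entry) =>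
     (all (fun r : n.-tuple _ => sums01 false (map val r)) t &&
     columns01 S [seq map val (val r) | r <- t])%:R)) /=.
  by rewrite size_S size_ys.
case=> size_xs size_ys size_S.
rewrite (sum_tuple_cons _ (fun t : seq (n.-tuple asm_entry) =>
     (all (fun r : n.-tuple _ => sums01 false (map val r)) t &&
     columns01 S [seq map val (val r) | r <- t])%:R)) /= size_ys.
have sz (r : n.-tuple asm_entry) : size (next_sums S (map val r)) == n.
  by rewrite size_map size_zip size_map size_tuple size_S minnn.
transitivity (\sum_(r : n.-tuple asm_entry) \sum_(T : n.-tuple bool)
   [&& sums01 false (map val r), fits_row S (map val r) & next_sums S (map val r) == T]%:R
   * grid_sum (@ice_rule P) xs ys T); last first.
  rewrite exchange_big; apply: eq_bigr => T _.
  by rewrite -mulr_suml (@sum_rows_ice _ x ys) // size_tuple.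
apply: eq_bigr => r _; rewrite (bigD1 (Tuple (sz r))) //= eqxx andbT.
rewrite [X in _ = _ + X]big1 ?addr0 => [|T neqT]; last first.
  suff /negPf-> : next_sums S (map val r) != T by rewrite !andbF mul0r.
  by apply: contraNneq neqT => E; apply/eqP/val_inj.
rewrite -(IH m) //; last exact/eqP.
rewrite mulr_sumr; apply: eq_bigr => t _; rewrite -natrM mulnb; congr (nat_of_bool _)%:R.
by rewrite /=; case: (sums01 _ _) (fits_row _ _) (all _ _) => [] [] [].
Qed.

(** A matrix is summed as a tuple of rows, so that the recursion of [grid_sum]
    over rows and columns applies; the parameters [xs] and [ys] only give the
    size. *)
Lemma num_asm_grid_sum (P : Type) (xs ys : seq P) n :
  size xs = n -> size ys = n ->
  (num_asm n)%:R = grid_sum (@ice_rule P) xs ys (nseq n false).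
Proof.
move=> size_xs size_ys; rewrite -(sum_matrices_ice size_xs size_ys (size_nseq _ _)).
rewrite /num_asm -sum1_card natr_sum big_mkcond /=.
pose rows_of (A : 'M[asm_entry]_n) := [tuple [tuple A i j | j < n] | i < n].
rewrite [RHS](reindex rows_of); last first.
  exists (fun t => \matrix_(i, j) tnth (tnth t i) j) => [A _ | t _].
    by apply/matrixP => i j; rewrite mxE !tnth_mktuple.
  by do 2!(apply: eq_from_tnth => ?; rewrite !tnth_mktuple); rewrite mxE.
apply: eq_bigr => A _; rewrite inE.
have entry (s : seq asm_entry) : all (mem [:: 0; 1; -1]) (map val s).
  by apply/allP => _ /mapP[a _ ->]; apply: valP.
set b := is_asm _; rewrite -[LHS]/(if b then 1 else 0) -[LHS]mulrb; congr (nat_of_bool _)%:R.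
rewrite (columns01P (size_nseq _ _)); last first.
  by rewrite all_map; apply/allP => r _ /=; rewrite size_map size_tuple.
have rowE i : row_seq (map_mx val A) i = map val [tuple A i j | j < n].
  by rewrite /row_seq -val_ord_tuple -[RHS]map_comp; apply: eq_map => j; rewrite mxE.
have colE (j : 'I_n) : [seq nth 0 r j | r <- [seq map val (val r) | r <- rows_of A]] =
   col_seq (map_mx val A) j.
  rewrite /col_seq /rows_of -val_ord_tuple -[LHS]map_comp -[LHS]map_comp; apply: eq_map => i; rewrite mxE.
  rewrite -[LHS]/(nth 0 (map val [tuple A i j0 | j0 < n]) j).
  rewrite (nth_map (A i j)) ?size_tuple // -tnth_nth tnth_mktuple //.
have colE' j : col_seq (map_mx val A) j = map val [tuple A i j | i < n].
  by rewrite /col_seq -val_ord_tuple -[RHS]map_comp; apply: eq_map => i; rewrite mxE.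
rewrite /b /is_asm; apply/idP/idP.
  case/and5P=> _ /forallP rsum /forallP csum /forallP ralt /forallP calt.
  apply/andP; split.
    apply/all_tnthP => i; rewrite tnth_mktuple sums01_alternating //.
    rewrite -rowE ralt andbT; have := rsum i.
    by rewrite /row_seq big_map big_enum.
  apply/forallP => j; rewrite nth_nseq ltn_ord colE colE' sums01_alternating //.
  by rewrite -colE' calt andbT; have := csum j; rewrite /col_seq big_map big_enum.
case/andP=> /all_tnthP rows /forallP cols.
have rows' i : (\sum_j (map_mx val A) i j == 1) && alternating (row_seq (map_mx val A) i).
  have := rows i; rewrite tnth_mktuple sums01_alternating // -rowE.
  by rewrite /row_seq big_map big_enum.
have cols' j : (\sum_i (map_mx val A) i j == 1) && alternating (col_seq (map_mx val A) j).
  have := cols j; rewrite nth_nseq ltn_ord colE colE' sums01_alternating // -colE'.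
  by rewrite /col_seq big_map big_enum.
apply/and5P; split; apply/forallP => i; try by case/andP: (rows' i); case/andP: (cols' i).
by apply/forallP => j; rewrite mxE; apply: valP.
Qed.

End Count.

(** * Divided differences and the series (1 + X)^(1/3) *)

Lemma vdm_affine (R : comNzRingType) n (c t : R) (x : 'I_n -> R) :
  vdm (fun i => c + t * x i) = t ^+ 'C(n, 2) * vdm x.
Proof.
elim: n x => [|n IH] x; first by rewrite /vdm !det_mx00 mul1r.
rewrite !vdmS -[vdm (tail _)]/(vdm (fun i => c + t * tail x i)) IH.
rewrite (eq_bigr (fun j => t * (x (lift ord0 j) - x ord0))); last by move=> j _; ring.
by rewrite big_split prodr_const card_ord binS bin1 exprD /= mulrACA [t ^+ n * _]mulrC.
Qed.

Lemma vdm_map (R S : comNzRingType) (f : {rmorphism R -> S}) n (x : 'I_n -> R) :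
  f (vdm x) = vdm (fun i => f (x i)).
Proof.
rewrite /vdm -det_map_mx; congr (\det _).
by apply/matrixP => i j; rewrite !mxE rmorphXn.
Qed.

Lemma vdm_neq0 (R : idomainType) n (x : 'I_n -> R) : injective x -> vdm x != 0.
Proof.
move=> x_inj; rewrite /vdm det_Vandermonde.
apply/prodf_neq0 => i _; apply/prodf_neq0 => j lt_ij; rewrite !mxE subr_eq0.
by apply/eqP => /x_inj eq_ij; rewrite eq_ij ltnn in lt_ij.
Qed.

(** Multiplying by S - T telescopes along the diagonals k + l = constant: only
    the terms with l = 0 or k = 0 survive. *)
Lemma divided_difference (R : comNzRingType) (a : nat -> R) (M : nat) (S T : R) :
  \sum_(k < M.+1) a k * S ^+ k - \sum_(k < M.+1) a k * T ^+ k =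
  (S - T) * \sum_(k < M) \sum_(l < M)
     (if (k + l < M)%N then a (k + l).+1 else 0) * (S ^+ k * T ^+ l).
Proof.
pose E k l := (if (k + l <= M)%N then a (k + l)%N else 0) * (S ^+ k * T ^+ l).
have rowE : \sum_(k < M.+1) \sum_(l < M.+1) E k l =
  \sum_(k < M.+1) a k * T ^+ k + \sum_(k < M) \sum_(l < M) E k.+1 l.
  rewrite big_ord_recl; congr (_ + _).
    by apply: eq_bigr => l _; rewrite /E add0n -ltnS ltn_ord mul1r.
  apply: eq_bigr => k _; rewrite big_ord_recr /= {2}/E /bump /= add1n ifF ?mul0r ?addr0 //.
  by rewrite addSn ltnNge leq_addl.
have colE : \sum_(k < M.+1) \sum_(l < M.+1) E k l =
  \sum_(k < M.+1) a k * S ^+ k + \sum_(k < M) \sum_(l < M) E k l.+1.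
  rewrite exchange_big big_ord_recl; congr (_ + _).
    by apply: eq_bigr => k _; rewrite /E addn0 -ltnS ltn_ord mulr1.
  rewrite exchange_big big_ord_recr /= [X in _ + X]big1 ?addr0 // => l _.
  by rewrite /E /bump /= add1n ifF ?mul0r // addnS ltnNge leq_addr.
transitivity (\sum_(k < M) \sum_(l < M) E k.+1 l - \sum_(k < M) \sum_(l < M) E k l.+1).
  by move/eqP: rowE; rewrite colE -subr_eq => /eqP <-; ring.
rewrite -sumrB mulr_sumr; apply: eq_bigr => k _.
rewrite -sumrB mulr_sumr; apply: eq_bigr => l _.
by rewrite /E addnS addSn !exprS; ring.
Qed.

Section CubeRoot.

Variable K : numFieldType.

Definition cbrt_coef (k : nat) : K := gbinom 3^-1 k.

Lemma cbrt_coef0 : cbrt_coef 0 = 1.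
Proof. by rewrite /cbrt_coef /gbinom big_ord0 divr1. Qed.

Lemma cbrt_coefS k : k.+1%:R * cbrt_coef k.+1 = (3^-1 - k%:R) * cbrt_coef k.
Proof.
rewrite /cbrt_coef /gbinom big_ord_recr /= factS natrM.
have k_neq0 : k.+1%:R != 0 :> K by rewrite pnatr_eq0.
have f_neq0 : k`!%:R != 0 :> K by rewrite pnatr_eq0 -lt0n fact_gt0.
rewrite invfM; move: k_neq0 f_neq0.
move: (k.+1%:R : K) (k`!%:R : K) => c f c_neq0 f_neq0; field; by rewrite c_neq0 f_neq0.
Qed.

Lemma cbrt_coef1 : cbrt_coef 1 = 3^-1.
Proof. by have := cbrt_coefS 0; rewrite cbrt_coef0 mulr1 mul1r subr0. Qed.

Definition cbrt_poly (N : nat) : {poly K} := \poly_(k < N) cbrt_coef k.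

(** The truncated binomial series g satisfies (1 + X) g' = g / 3 below its last
    degree, hence G = g^3 satisfies (1 + X) G' = G there, and the recurrence
    that this gives for the coefficients of G has 1, 1, 0, 0, ... as its only
    solution starting with 1. *)
Lemma cbrt_poly_cube N : exists r : {poly K},
  cbrt_poly N ^+ 3 = 1 + 'X + 'X^N * r.
Proof.
set g := cbrt_poly N; pose D := (1 + 'X) * g^`() - 3^-1 *: g.
have cg i : g`_i = if (i < N)%N then cbrt_coef i else 0 by rewrite coef_poly.
have D0 k : (k.+1 < N)%N -> D`_k = 0.
  have dg i : (i.+1 < N)%N -> g^`()`_i = (3^-1 - i%:R) * cbrt_coef i.
    by move=> lt_iN; rewrite coef_deriv cg lt_iN -cbrt_coefS mulr_natl.
  move=> lt_kN; rewrite /D coefB mulrDl mul1r coefD coefXM coefZ dg //.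
  rewrite cg (ltnW lt_kN).
  case: k lt_kN => [|k] lt_kN; first by rewrite subr0 addr0 subrr.
  by rewrite /= dg ?(ltnW lt_kN) // -(cbrt_coefS k); ring.
have ode : (1 + 'X) * (g ^+ 3)^`() - g ^+ 3 = 3 *: (g ^+ 2 * D).
  have three : (3^-1 : K)%:P * 3 = 1 by rewrite -polyC_natr -polyCM mulVf ?pnatr_eq0.
  rewrite deriv_exp /D -!mul_polyC polyC_natr -[g ^+ 3]mul1r -[X in _ - X * _]three /=.
  by move: (3^-1)%:P => c; ring.
have rec k : (k.+1 < N)%N -> k.+1%:R * (g ^+ 3)`_k.+1 = (1 - k%:R) * (g ^+ 3)`_k.
  move=> lt_kN; have /(congr1 (fun p : {poly K} => p`_k)) := ode.
  rewrite coefZ coefM big1 ?mulr0 => [|i _]; last first.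
    by rewrite D0 ?mulr0 // (leq_ltn_trans _ lt_kN) // ltnS leq_subr.
  have dG i : (g ^+ 3)^`()`_i = i.+1%:R * (g ^+ 3)`_i.+1.
    by rewrite coef_deriv mulr_natl.
  rewrite coefB mulrDl mul1r coefD coefXM dG => E.
  apply/eqP; rewrite -subr_eq0; apply/eqP; rewrite -[RHS]E.
  case: k lt_kN {E} => [|k] lt_kN; first by rewrite /=; ring.
  by rewrite /= dG -![k.+2%:R]natr1; ring.
exists (drop_poly N (g ^+ 3 - (1 + 'X))).
rewrite mulrC -[LHS](subrK (1 + 'X)) addrC; congr (_ + _).
rewrite -{1}[X in X = _](poly_take_drop N) -[RHS]add0r; congr (_ + _).
apply/polyP => k; rewrite coef0 coef_take_poly; case: ifP => // lt_kN.
apply/eqP; rewrite coefB subr_eq0 coefD coef1 coefX; apply/eqP.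
have N_gt0 : (0 < N)%N by apply: leq_ltn_trans lt_kN.
have G0 : (g ^+ 3)`_0 = 1.
  by rewrite -horner_coef0 horner_exp horner_coef0 cg N_gt0 cbrt_coef0 expr1n.
have G1 : (1 < N)%N -> (g ^+ 3)`_1 = 1.
  by move=> N_gt1; have := rec 0 N_gt1; rewrite mul1r G0 subr0 mul1r.
case: k lt_kN => [|[|k]] lt_kN; rewrite ?addr0 ?add0r //=; first exact: G1.
have nz m : m.+1%:R != 0 :> K by rewrite pnatr_eq0.
elim: k lt_kN => [|k IH] lt_kN.
  by apply: (mulfI (nz 1)); rewrite rec // subrr mul0r mulr0.
by apply: (mulfI (nz k.+2)); rewrite rec // IH ?mulr0 // ltnW.
Qed.

End CubeRoot.

(** * Lowest coefficient of a determinant *)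

Section Leading.

Variable K : fieldType.

Definition scaled_pow n N (u : 'I_n -> K) : 'M[{poly K}]_(n, N) :=
  \matrix_(i, k) (u i *: 'X) ^+ k.

Lemma det_scaled_pow n (u : 'I_n -> K) :
  \det (scaled_pow n u) = 'X^('C(n, 2)) * (vdm u)%:P.
Proof.
have -> : scaled_pow n u = (Vandermonde n (\row_i (0 + 'X * (u i)%:P)))^T.
  by apply/matrixP => i j; rewrite !mxE add0r mulrC mul_polyC.
rewrite det_tr -[\det _]/(vdm (fun i => 0 + 'X * (u i)%:P)) vdm_affine.
by rewrite (vdm_map (polyC : {rmorphism K -> {poly K}})).
Qed.

(** The columns beyond the n-th are combinations of the first n with
    coefficients divisible by X, because the vectors (u_i^k)_i with k < n span
    the whole space. *)
Lemma scaled_pow_factor n r (u : 'I_n -> K) : vdm u != 0 ->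
  exists2 E : 'M[{poly K}]_(n, r), map_mx (horner_eval 0) E = 0 &
    scaled_pow (n + r) u = scaled_pow n u *m row_mx 1%:M E.
Proof.
move=> u_neq0.
pose V := (Vandermonde n (\row_i u i))^T.
pose V2 : 'M[K]_(n, r) := \matrix_(i, k) u i ^+ (n + k).
have unitV : V \in unitmx by rewrite unitmx_tr unitmxE unitfE.
(* u_i^(n + k) is a combination of the u_i^m, with the coefficients below; the
   powers of X are matched by X^(n + k - m), which vanishes at 0 as m < n *)
exists (\matrix_(m, k) ((invmx V *m V2) m k *: 'X^(n + k - m))).
  apply/matrixP => m k; rewrite !mxE horner_evalE hornerZ hornerXn expr0n.
  by rewrite subn_eq0 leqNgt ltn_addr // mulr0.
rewrite mul_mx_row mulmx1; apply/matrixP => i j; rewrite [LHS]mxE [RHS]mxE.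
case: split_ordP => k ->; rewrite ?mxE //=.
transitivity ((V *m (invmx V *m V2)) i k *: 'X^(n + k) : {poly K}).
  by rewrite mulKVmx // mxE exprZn.
rewrite mxE scaler_suml; apply: eq_bigr => m _; rewrite !mxE exprZn.
rewrite -scalerAl -scalerAr scalerA -exprD subnKC //.
by rewrite ltnW // ltn_addr.
Qed.

(** By [scaled_pow_factor] only the upper left block of [H] contributes to the
    lowest order. *)
Lemma det_scaled_lead n r (u v : 'I_n -> K) (H : 'M[K]_(n + r)) :
  vdm u != 0 -> vdm v != 0 ->
  exists2 Q : {poly K}, Q.[0] = vdm u * vdm v * \det (ulsubmx H) &
  \det (scaled_pow (n + r) u *m map_mx polyC H *m (scaled_pow (n + r) v)^T) =
    'X^('C(n, 2)) * 'X^('C(n, 2)) * Q.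
Proof.
move=> /(scaled_pow_factor r)[E E0 ->] /(scaled_pow_factor r)[F F0 ->].
exists ((vdm u)%:P * (vdm v)%:P *
   \det (row_mx 1%:M E *m map_mx polyC H *m (row_mx 1%:M F)^T)).
  rewrite !hornerM !hornerC; congr (_ * _).
  rewrite -horner_evalE -det_map_mx !map_mxM -map_trmx !map_row_mx !map_mx1 E0 F0.
  have -> : map_mx (horner_eval 0) (map_mx polyC H) = H.
    by apply/matrixP => i j; rewrite !mxE horner_evalE hornerC.
  rewrite -[H]submxK mul_row_block tr_row_mx mul_row_col trmx1 trmx0 !mulmx0 addr0.
  by rewrite mulmx1 mul1mx mul0mx addr0 submxK.
set U := scaled_pow n u; set V := scaled_pow n v.
have -> : U *m row_mx 1%:M E *m map_mx polyC H *m (V *m row_mx 1%:M F)^T =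
    U *m (row_mx 1%:M E *m map_mx polyC H *m (row_mx 1%:M F)^T) *m V^T.
  by rewrite trmx_mul !mulmxA.
rewrite !det_mulmx det_tr !det_scaled_pow.
by move: (\det _) => D; ring.
Qed.

Lemma dvdp_det n (d : {poly K}) (A B : 'M[{poly K}]_n) :
  (forall i j, d %| A i j - B i j) -> d %| \det A - \det B.
Proof.
move=> dAB; apply: (big_ind2 (fun p q => d %| p - q)) => [|p p' q q' dp dq|s _].
- by rewrite subrr dvdp0.
- have -> : p + q - (p' + q') = (p - p') + (q - q') by ring.
  exact: dvdp_add.
rewrite -mulrBr dvdp_mull //.
apply: (big_ind2 (fun p q => d %| p - q)) => [|p p' q q' dp dq|i _ //].
  by rewrite subrr dvdp0.
have -> : p * q - p' * q' = p * (q - q') + q' * (p - p') by ring.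
by rewrite dvdp_add // dvdp_mull.
Qed.

End Leading.

(** * The partition function at the point 1 *)

Section GridMorph.

Variables (R S : comNzRingType) (f : {rmorphism R -> S}) (P Q : Type) (g : P -> Q).
Variables (w : P -> P -> bool -> bool -> bool -> bool -> R)
          (w' : Q -> Q -> bool -> bool -> bool -> bool -> S).
Hypothesis fw : forall x y h v h' v', f (w x y h v h' v') = w' (g x) (g y) h v h' v'.

Lemma rmorph_row_weight x ys h A h' B :
  f (row_weight w x ys h A h' B) = row_weight w' (g x) (map g ys) h A h' B.
Proof.
elim: ys h A B => [|y ys IH] h [|a A] [|b B] /=; rewrite ?rmorph0 ?rmorph_nat //.
by rewrite rmorph_sum; apply: eq_bigr => k _; rewrite rmorphM fw IH.
Qed.

Lemma rmorph_grid_sum xs ys A : f (grid_sum w xs ys A) = grid_sum w' (map g xs) (map g ys) A.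
Proof.
elim: xs A => [|x xs IH] A /=; rewrite size_map ?rmorph_nat // rmorph_sum.
by apply: eq_bigr => T _; rewrite rmorphM rmorph_row_weight IH.
Qed.

End GridMorph.

Section ConstantWeights.

Variables (R : comNzRingType) (P : Type) (c : R).
Variables (w w' : P -> P -> bool -> bool -> bool -> bool -> R).
Variables (x0 y0 : P).
Hypothesis ww' : forall h v h' v', w x0 y0 h v h' v' = c * w' x0 y0 h v h' v'.

Lemma row_weight_const n h S h' T :
  row_weight w x0 (nseq n y0) h S h' T = c ^+ n * row_weight w' x0 (nseq n y0) h S h' T.
Proof.
elim: n h S T => [|n IH] h [|s S] [|t T] /=; rewrite ?mulr0 ?mul1r //.
by rewrite mulr_sumr; apply: eq_bigr => k _; rewrite ww' IH exprS; ring.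
Qed.

Lemma grid_sum_const m n S :
  grid_sum w (nseq m x0) (nseq n y0) S = c ^+ (m * n) * grid_sum w' (nseq m x0) (nseq n y0) S.
Proof.
elim: m S => [|m IH] S /=; first by rewrite mul1r.
rewrite mulr_sumr; apply: eq_bigr => T _.
by rewrite row_weight_const IH mulSn exprD; ring.
Qed.

End ConstantWeights.

Lemma rmorph_domain_wall (R S : idomainType) (f : {rmorphism R -> S}) (w : R) n (x y : 'I_n -> R) :
  f (domain_wall w x y) = domain_wall (f w) (fun i => f (x i)) (fun i => f (y i)).
Proof.
rewrite /domain_wall (@rmorph_grid_sum _ _ f _ _ f _ (weight (f w))); last first.
  by move=> a b [] [] [] [] /=; rewrite ?(rmorph0, rmorphM, rmorphB, rmorphXn) //= ?rmorphM ?rmorphXn.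
by congr grid_sum; rewrite -map_comp.
Qed.

Lemma domain_wall_ones (R : idomainType) (w : R) n :
  domain_wall w (fun _ : 'I_n => 1) (fun _ : 'I_n => 1) = (w - w ^+ 2) ^+ (n * n) * (num_asm n)%:R.
Proof.
have ones : [seq (1 : R) | i <- enum 'I_n] = nseq n 1.
  by apply: (@eq_from_nth _ 0) => [|i]; rewrite ?size_nseq size_map size_enum_ord // => lt_i;
     rewrite (nth_map (Ordinal lt_i)) ?size_enum_ord // nth_nseq lt_i.
rewrite /domain_wall ones (@grid_sum_const _ _ (w - w ^+ 2) _ (@ice_rule R R)).
  by rewrite -(@num_asm_grid_sum _ _ (nseq n 1) (nseq n 1) n) ?size_nseq.
by move=> [] [] [] []; rewrite /ice_rule /= ?mulr1 ?mulr0.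
Qed.

(** * The homogeneous limit *)

Section Limit.

Variable (K : numFieldType) (w : K).
Hypothesis w_root : w ^+ 2 + w + 1 = 0.
Variable n : nat.
Hypothesis n_gt0 : (0 < n)%N.

Let r := (n * n)%N.
Let M := (n + r)%N.
Let p : {poly K} := cbrt_poly K M.+1.
Let a := cbrt_coef K.

(** (1 + u X)^(1/3) modulo X^(M + 1); the precision M exceeds the order
    n (n - 1) at which the two sides are compared. *)
Definition root_at (u : K) : {poly K} := p \Po (u *: 'X).

(** The truncation of (s - t) / (s^3 - t^3) = 1 / [qform s t] at
    s = (1 + u X)^(1/3) and t = (1 + v X)^(1/3). *)
Definition cauchy_kernel (u v : K) : {poly K} :=
  \sum_(k < M) \sum_(l < M) (if (k + l < M)%N then (a (k + l).+1)%:P else 0) *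
     ((u *: 'X) ^+ k * (v *: 'X) ^+ l).

Lemma root_atE u : root_at u = \sum_(k < M.+1) (a k)%:P * (u *: 'X) ^+ k.
Proof.
rewrite /root_at /p /cbrt_poly poly_def linear_sum; apply: eq_bigr => k _ /=.
by rewrite comp_polyZ comp_Xn_poly mul_polyC.
Qed.

Lemma root_at_cube u : 'X^(M.+1) %| root_at u ^+ 3 - (1 + u *: 'X).
Proof.
have [s /(congr1 (comp_poly (u *: 'X)))] := cbrt_poly_cube K M.+1.
rewrite rmorphXn !rmorphD rmorph1 rmorphM /= comp_polyX comp_Xn_poly -[comp_poly _ _]/(root_at u).
by move=> ->; rewrite addrAC subrr add0r exprZn -scalerAl scalerAr dvdp_mulIl.
Qed.

Lemma root_atB u v : root_at u - root_at v = ((u - v) *: 'X) * cauchy_kernel u v.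
Proof. by rewrite !root_atE (divided_difference (fun k => (a k)%:P)) -scalerBl. Qed.

(** Multiplied by s - t, this says that s^3 - t^3 is (u - v) X up to the
    precision of the series. *)
Lemma qform_cauchy_kernel u v : u != v ->
  'X^M %| qform (root_at u) (root_at v) * cauchy_kernel u v - 1.
Proof.
move=> neq_uv.
have d_neq0 : (u - v) *: 'X != 0 :> {poly K} by rewrite scaler_eq0 polyX_eq0 orbF subr_eq0.
rewrite -(dvdp_mul2l _ _ d_neq0).
have -> : (u - v) *: 'X * (qform (root_at u) (root_at v) * cauchy_kernel u v - 1) =
  (root_at u ^+ 3 - (1 + u *: 'X)) - (root_at v ^+ 3 - (1 + v *: 'X)).
  rewrite mulrBr mulrCA -root_atB /qform mulr1 scalerBl; ring.
rewrite -scalerAl dvdpZl ?subr_eq0 // -exprS.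
by rewrite dvdp_sub // root_at_cube.
Qed.

Definition slope_at (u : K) : {poly K} :=
  \sum_(k < M) (a k.+1 * u ^+ k.+1) *: 'X^k.

Lemma root_at_slope u : root_at u = 1 + 'X * slope_at u.
Proof.
rewrite root_atE big_ord_recl /a cbrt_coef0 expr0 mulr1; congr (_ + _).
rewrite mulr_sumr; apply: eq_bigr => k _.
by rewrite mul_polyC exprZn scalerA -scalerAr ?lift0 -exprS.
Qed.

Lemma root_at0 u : (root_at u).[0] = 1.
Proof. by rewrite root_at_slope hornerD hornerM hornerX mul0r addr0 hornerC. Qed.

Lemma slope_at0 u : (slope_at u).[0] = 0 + 3^-1 * u.
Proof.
rewrite /slope_at; have -> : M = M.-1.+1 by rewrite prednK // /M addn_gt0 n_gt0.
rewrite big_ord_recl hornerD hornerZ hornerXn expr0 mulr1 expr1 /a cbrt_coef1.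
rewrite horner_sum big1 => [|k _]; first by rewrite addr0 add0r.
by rewrite hornerZ hornerXn expr0n mulr0.
Qed.

Lemma root_at_inj : injective root_at.
Proof.
move=> u v; rewrite !root_at_slope => /addrI/(mulfI (negbT (polyX_eq0 _))) eq_uv.
have := slope_at0 u; rewrite eq_uv slope_at0 !add0r => /mulfI -> //.
by rewrite invr_eq0 pnatr_eq0.
Qed.

Variables (u v : 'I_n -> K).
Hypotheses (u_inj : injective u) (v_inj : injective v) (uv : forall i j, u i != v j).

Let x i := root_at (u i).
Let y i := root_at (v i).

Lemma cauchy_kernel_mx :
  \matrix_(i, j) cauchy_kernel (u i) (v j) =
  scaled_pow M u *m map_mx polyC (\matrix_(k, l) (if (k + l < M)%N then a (k + l).+1 else 0))
    *m (scaled_pow M v)^T.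
Proof.
apply/matrixP => i j; rewrite !mxE /cauchy_kernel exchange_big; apply: eq_bigr => l _.
rewrite !mxE mulr_suml; apply: eq_bigr => k _; rewrite !mxE.
by case: ifP => _; ring.
Qed.

(** Multiplying row i of the kernel by all its denominators turns it into
    [cleared_mx] up to the precision of the series. *)
Lemma det_cleared_cong :
  'X^M %| (\prod_i \prod_j qform (x i) (y j)) * \det (\matrix_(i, j) cauchy_kernel (u i) (v j))
     - \det (cleared_mx x y).
Proof.
have -> : \prod_i \prod_j qform (x i) (y j) =
   \det (diag_mx (\row_i \prod_j qform (x i) (y j))).
  by rewrite det_diag; apply: eq_bigr => i _; rewrite mxE.
rewrite -det_mulmx; apply: dvdp_det => i j; rewrite mul_diag_mx !mxE (bigD1 j) //=.
set c := \prod_(k | _) _.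
have -> : qform (x i) (y j) * c * cauchy_kernel (u i) (v j) - c =
  c * (qform (x i) (y j) * cauchy_kernel (u i) (v j) - 1) by ring.
by rewrite dvdp_mull // qform_cauchy_kernel.
Qed.

(** Each root is 1 + X times a series starting with u / 3, so the difference of
    two of them is divisible by X. *)
Lemma vdm_root_at (z : 'I_n -> K) : exists2 q : {poly K},
  q.[0] = 3^-1 ^+ 'C(n, 2) * vdm z & vdm (fun i => root_at (z i)) = 'X^('C(n, 2)) * q.
Proof.
exists (vdm (fun i => slope_at (z i))).
  rewrite -horner_evalE vdm_map -(vdm_affine 0); congr (\det (Vandermonde _ _)).
  by apply/matrixP => i j; rewrite !mxE -[LHS]/((slope_at (z j)).[0]) slope_at0.
rewrite -(vdm_affine 1 'X); congr (\det (Vandermonde _ _)).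
by apply/matrixP => i j; rewrite !mxE root_at_slope.
Qed.

Lemma izergin_korepin_root_at : izergin_korepin w%:P x y.
Proof.
have w2_neq1 : w ^+ 2 != 1.
  apply/eqP => w21; have w_eq : w = -2 by rewrite -[LHS]subr0 -w_root w21; ring.
  move: w21; rewrite w_eq => /eqP; rewrite -subr_eq0.
  have -> : (-2) ^+ 2 - 1 = 3%:R :> K by ring.
  by rewrite pnatr_eq0.
have w_neq : w - w ^+ 2 != 0.
  rewrite subr_eq0; apply: contra w2_neq1 => /eqP ww2.
  have : w * (w - 1) = 0 by rewrite mulrBr -expr2 -ww2 mulr1 subrr.
  move/eqP; rewrite mulf_eq0 subr_eq0 => /orP[/eqP w0|/eqP ->]; last by rewrite expr1n.
  by move: w_root; rewrite w0 expr0n /= !add0r => /eqP; rewrite oner_eq0.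
apply: izergin_korepin_formula.
- by rewrite -polyC_exp -polyC1 -!polyCD w_root.
- by move=> i j /root_at_inj/u_inj.
- by move=> i j /root_at_inj/v_inj.
- move=> i j; apply/eqP => /(congr1 (horner^~ 0))/eqP.
  by rewrite -polyC_exp hornerD hornerN !hornerM !hornerC !root_at0 !mulr1 (negPf w_neq).
move=> i j; apply/eqP => /(congr1 (horner^~ 0))/eqP.
by rewrite -polyC_exp hornerM hornerC !root_at0 mulr1 eq_sym (negPf w2_neq1).
Qed.

(** Both sides of the Izergin-Korepin formula are divisible by X^(n (n - 1));
    dividing by it and setting X = 0 leaves the count on the left and the Hankel
    determinant on the right.  The factors w - w^2 are removed with
    (w - w^2)^2 = -3. *)
Lemma asm_det_limit :
  (num_asm n)%:R = 3 ^+ ('C(n, 2) + n * n) * \det (\matrix_(i < n, j < n) a (i + j).+1).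
Proof.
have [Q Q0 QE] := @det_scaled_lead K n r u v
  (\matrix_(k, l) (if (k + l < M)%N then a (k + l).+1 else 0)) (vdm_neq0 u_inj) (vdm_neq0 v_inj).
have [pu pu0 puE] := vdm_root_at u.
have [pv pv0 pvE] := vdm_root_at v.
have := det_cleared_cong; rewrite cauchy_kernel_mx QE => /dvdpP[s].
set C := 'C(n, 2) in QE pu0 puE pv0 pvE *; set q := \prod_i _ => /eqP.
rewrite subr_eq => /eqP detE.
have := izergin_korepin_root_at; rewrite /izergin_korepin -[vdm x]/(vdm (fun i => root_at (u i))) puE.
rewrite -[vdm y]/(vdm (fun i => root_at (v i))) pvE -/C => ik.
have CC : (C * 2 = n * n.-1)%N by rewrite /C (bin_ffact n 2) ffactnS ffactn1.
have C_M : M = (C + C + (M - (C + C)))%N.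
  by rewrite subnKC // /M /r; move: CC; nia.
have X_neq0 : 'X^C * 'X^C != 0 :> {poly K} by rewrite -exprD monic_neq0 ?monicXn.
have {}ik : (-1) ^+ C * domain_wall w%:P x y * pu * pv =
   (w%:P - w%:P ^+ 2) ^+ n * (\prod_i x i) * (q * Q - s * 'X^(M - (C + C))).
  apply: (mulfI X_neq0).
  transitivity ((-1) ^+ C * domain_wall w%:P x y * ('X^C * pu) * ('X^C * pv)); first by ring.
  rewrite ik; have -> : \det (cleared_mx x y) = q * ('X^C * 'X^C * Q) - s * 'X^M.
    by rewrite detE; ring.
  by rewrite {1}C_M !exprD; ring.
have pos : (0 < M - (C + C))%N by rewrite subn_gt0; move: CC; rewrite /M /r; nia.
have pf0 : (domain_wall w%:P x y).[0] = (w - w ^+ 2) ^+ (n * n) * (num_asm n)%:R.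
  rewrite -domain_wall_ones -horner_evalE rmorph_domain_wall /= horner_evalE hornerC /domain_wall.
  by congr grid_sum; apply: eq_map => i; rewrite horner_evalE root_at0.
have x0 : (\prod_i x i).[0] = 1.
  by rewrite horner_prod big1 // => i _; rewrite root_at0.
have q0 : q.[0] = 3 ^+ (n * n).
  rewrite horner_prod (eq_bigr (fun=> 3 ^+ n)) => [|i _].
    by rewrite prodr_const card_ord exprM.
  rewrite horner_prod (eq_bigr (fun=> 3)) => [|j _]; first by rewrite prodr_const card_ord.
  by rewrite /qform !hornerD !horner_exp hornerM !root_at0; ring.
have H0 : ulsubmx (\matrix_(k < n + r, l < n + r) (if (k + l < M)%N then a (k + l).+1 else 0))
    = \matrix_(i < n, j < n) a (i + j).+1.
  apply/matrixP => i j; rewrite !mxE /= ifT // /M /r.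
  by move: (ltn_ord i) (ltn_ord j); nia.
rewrite H0 in Q0.
have := congr1 (horner^~ 0) ik.
rewrite !hornerM hornerD hornerN !hornerM hornerXn !horner_exp hornerD !hornerN horner_exp !hornerC.
rewrite pf0 pu0 pv0 x0 q0 Q0 expr0n (gtn_eqF pos) mulr0 subr0 mulr1.
have T2 : (w - w ^+ 2) ^+ 2 = -3.
  have w2 : w ^+ 2 = - w - 1 by rewrite -[LHS]subr0 -w_root; ring.
  by ring: w2.
have T_neq0 : w - w ^+ 2 != 0.
  by apply: contra_eq_neq T2 => ->; rewrite expr0n /= eq_sym oppr_eq0 pnatr_eq0.
have -> : (n * n = n + 2 * C)%N by move: CC; nia.
have pow2 (z : K) : z ^+ (n + 2 * C) = z ^+ n * (z ^+ 2) ^+ C by rewrite exprD exprM.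
rewrite [3 ^+ (C + _)]exprD !pow2 T2 -(mulN1r 3) exprMn exprVn.
have p_neq0 : 3 ^+ C != 0 :> K by rewrite expf_neq0 // pnatr_eq0.
have sgn2 : (-1) ^+ C * (-1) ^+ C = 1 :> K by rewrite -exprD addnn -signr_odd odd_double.
have := mulf_neq0 (expf_neq0 n T_neq0) (mulf_neq0 (vdm_neq0 u_inj) (vdm_neq0 v_inj)).
move: p_neq0 sgn2; move: (3 ^+ C) ((-1) ^+ C) ((w - w ^+ 2) ^+ n) => z e t.
move: (vdm u) (vdm v) (\det _) (3 ^+ n) ((3 ^+ 2) ^+ C) ((num_asm n)%:R) => du dv D c c2 A.
move=> z_neq0 e2 t_neq0 E; apply: (mulfI t_neq0).
transitivity (z * (t * (c * c2 * (du * dv * D)))); last by ring.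
rewrite -E; transitivity ((e * e) * t * du * dv * A); first by rewrite e2; ring.
by field.
Qed.

End Limit.

(** * The Hankel determinant of the series *)

Lemma C_hatE (k : nat) : C_hat k = 3 * cbrt_coef rat k.+1 * (-9) ^+ k.
Proof.
rewrite /C_hat /fps_scale /fps_divX /fps_sub /fps_one /binomial_series /= sub0r.
by rewrite exprS -/(cbrt_coef rat k.+1); field.
Qed.

Lemma hankel_det_C_hat n :
  hankel_det n C_hat =
  3 ^+ (n + 4 * 'C(n, 2)) * \det (\matrix_(i < n, j < n) cbrt_coef rat (i + j).+1).
Proof.
pose d : 'rV[rat]_n := \row_i (-9) ^+ i.
set H := \matrix_(_, _) cbrt_coef _ _.
have -> : hankel_det n C_hat = \det (3 *: (diag_mx d *m H *m diag_mx d)).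
  congr (\det _); apply/matrixP => i j.
  by rewrite mxE C_hatE mul_mx_diag mul_diag_mx !mxE exprD; ring.
rewrite detZ !det_mulmx det_diag.
have -> : \prod_i d 0 i = (-9) ^+ 'C(n, 2).
  rewrite (eq_bigr (fun i : 'I_n => (-9) ^+ i)) => [|i _]; last by rewrite mxE.
  by rewrite prodrXr -bin2_sum big_mkord.
have -> : (n + 4 * 'C(n, 2) = n + 2 * ('C(n, 2) + 'C(n, 2)))%N by lia.
rewrite exprD exprM [(3 ^+ 2) ^+ _]exprD (_ : -9 = (-1) * 3 ^+ 2); last by ring.
rewrite exprMn; have sgn2 : (-1) ^+ 'C(n, 2) * (-1) ^+ 'C(n, 2) = 1 :> rat.
  by rewrite -exprD addnn -signr_odd odd_double.
move: sgn2; move: ((-1) ^+ _) ((3 ^+ 2) ^+ _) (3 ^+ n) (\det _) => e q t D e2.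
by transitivity ((e * e) * (t * (q * q) * D)); [ring | rewrite e2 mul1r].
Qed.

(** The limit needs a cube root of unity, and is therefore taken in the
    algebraic numbers, for the parameters u_i = i and v_j = n + j. *)
Lemma num_asm_det n :
  (num_asm n)%:R = 3 ^+ ('C(n, 2) + n * n) *
    \det (\matrix_(i < n, j < n) cbrt_coef rat (i + j).+1).
Proof.
case: n => [|n].
  by rewrite (@num_asm_grid_sum _ nat [::] [::]) //= det_mx00 mul1r.
have [w prim_w] := C_prim_root_exists (isT : 0 < 3)%N.
have w_root : w ^+ 2 + w + 1 = 0.
  have w_neq1 : w - 1 != 0.
    by rewrite subr_eq0 -[w]expr1 -(prim_order_dvd prim_w).
  apply: (mulfI w_neq1); rewrite mulr0.
  by transitivity (w ^+ 3 - 1); [ring | rewrite prim_expr_order ?subrr].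
apply: (fmorph_inj (ratr : {rmorphism rat -> algC})).
rewrite rmorph_nat rmorphM rmorphXn /= rmorph_nat -det_map_mx.
rewrite (@asm_det_limit algC w w_root n.+1 isT (fun i => i%:R) (fun i => (n.+1 + i)%:R)).
- congr (_ * \det _); apply/matrixP => i j; rewrite !mxE /cbrt_coef /gbinom.
  rewrite fmorph_div rmorph_prod rmorph_nat; congr (_ / _); apply: eq_bigr => k _.
  by rewrite rmorphB /= fmorphV !rmorph_nat.
- by move=> i j /eqP; rewrite eqr_nat => /eqP/val_inj.
- by move=> i j /eqP; rewrite eqr_nat eqn_add2l => /eqP/val_inj.
by move=> i j; rewrite eqr_nat neq_ltn ltn_addr.
Qed.

Theorem theorem5p1 (n : nat) :
  (num_asm n)%:R = 3 ^- 'C(n, 2) * hankel_det n C_hat :> rat.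
Proof.
rewrite num_asm_det hankel_det_C_hat mulrA; congr (_ * _).
have -> : (n + 4 * 'C(n, 2) = 'C(n, 2) + ('C(n, 2) + n * n))%N.
  have : ('C(n, 2) * 2 = n * n.-1)%N by rewrite (bin_ffact n 2) ffactnS ffactn1.
  by case: (n) => [|m] /=; nia.
by rewrite [in RHS]exprD mulrA mulVf ?mul1r // expf_neq0.
Qed.
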